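(* Let $\mathcal{C}$ be a nondegenerate $[n,k]_{q^m/q}$ code with $n\ge(k-1)m+1$. Then $\mathcal{C}$ is minimal.
   Context: Let $q$ be a prime power and $n,m,k$ positive integers. For $v\in\mathbb{F}_{q^m}^n$ and an ordered basis $\Gamma=(\gamma_1,\dots,\gamma_m)$ of $\mathbb{F}_{q^m}$ over $\mathbb{F}_q$, let $\Gamma(v)\in\mathbb{F}_q^{n\times m}$ be the matrix with $v_i=\sum_{j}\Gamma(v)_{ij}\gamma_j$. The rank support $\sigma^{\mathrm{rk}}(v)\subseteq\mathbb{F}_q^n$ is the column space of $\Gamma(v)$ (independent of $\Gamma$). An $[n,k]_{q^m/q}$ code is a $k$-dimensional $\mathbb{F}_{q^m}$-subspace $\mathcal{C}\subseteq\mathbb{F}_{q^m}^n$; it is nondegenerate if $\sum_{v\in\mathcal{C}}\sigma^{\mathrm{rk}}(v)=\mathbb{F}_q^n$, and it is minimal if for all $v,v'\in\mathcal{C}$, $\sigma^{\mathrm{rk}}(v')\subseteq\sigma^{\mathrm{rk}}(v)$ implies $v'=\alpha v$ for some $\alpha\in\mathbb{F}_{q^m}$. *)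

(* Defs.v *)
From HB Require Import structures.
From mathcomp Require Import all_boot all_algebra all_field.

Set Implicit Arguments.
Unset Strict Implicit.
Unset Printing Implicit Defensive.

Import GRing.Theory.
Local Open Scope ring_scope.

Section RankMetric.

Variables (F : finFieldType) (L : fieldExtType F) (n : nat).
Implicit Types (v : 'cV[L]_n) (C : {vspace 'cV[L]_n}).

Definition coord_mx (m : nat) (G : m.-tuple L) v : 'M[F]_(n, m) :=
  \matrix_(i < n, j < m) coord G j (v i 0).

Definition colspace (m : nat) (A : 'M[F]_(n, m)) : {vspace 'cV[F]_n} :=
  <<[seq col j A | j : 'I_m]>>%VS.

(* Computed in the library's basis of L over F; any other ordered basis gives
   the same subspace, see [rank_supportE]. *)
Definition rank_support v : {vspace 'cV[F]_n} :=
  colspace (coord_mx (vbasis {:L}) v).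

(* [finvect_type L] is L with its finite type structure, which makes the sum
   over the codewords a finite sum. *)
Definition nondegenerate_code C : Prop :=
  (\sum_(v : 'cV[finvect_type L]_n | (v : 'cV[L]_n) \in C) rank_support v)%VS
    = fullv.

Definition minimal_code C : Prop :=
  forall v v', v \in C -> v' \in C ->
    (rank_support v' <= rank_support v)%VS ->
    exists a : L, v' = a *: v.

Lemma coord_mxE (m : nat) (G : m.-tuple L) v i :
  basis_of {:L} G -> v i 0 = \sum_(j < m) coord_mx G v i j *: G`_j.
Proof.
move=> bG; rewrite {1}(coord_basis bG (memvf (v i 0))).
by apply: eq_bigr => j _; rewrite mxE.
Qed.

Lemma colspace_coord_sub (m m' : nat) (G : m.-tuple L) (H : m'.-tuple L) v :
  basis_of {:L} G ->
  (colspace (coord_mx H v) <= colspace (coord_mx G v))%VS.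
Proof.
move=> bG; apply/span_subvP => _ /mapP[j _ ->].
have -> : col j (coord_mx H v) =
    \sum_(l < m) coord H j G`_l *: col l (coord_mx G v).
  apply/matrixP => i k; rewrite summxE !mxE (coord_mxE v i bG) linear_sum /=.
  by apply: eq_bigr => l _; rewrite linearZ /= !mxE mulrC.
apply: memv_suml => l _; apply/memvZ/memv_span/map_f.
by rewrite mem_enum.
Qed.

Lemma rank_supportE (m : nat) (G : m.-tuple L) v :
  basis_of {:L} G -> rank_support v = colspace (coord_mx G v).
Proof.
move=> bG; apply/eqP; rewrite eqEsubv !colspace_coord_sub //.
exact: vbasisP.
Qed.

End RankMetric.

(* Main.v *)
Require Import Defs.
From mathcomp Require Import all_boot all_algebra all_field.

Import GRing.Theory.
Local Open Scope ring_scope.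

(** A vector [x] of F^n is orthogonal to the rank support of a codeword [v]
  exactly when [x . v = 0] in L.  If [v'] is not a multiple of [v], some
  subspace [W] of [C] contains [v], has dimension at most [k - 1], and spans
  [C] together with [v'].  Being orthogonal to [W] amounts to [(k - 1) m < n]
  linear equations over F, so some nonzero [x] is orthogonal to [W].  If the
  support of [v'] lies in that of [v], then [x] is also orthogonal to [v'],
  hence to all of [C], which contradicts nondegeneracy. *)

(** Placed side by side, the [A i] form a matrix with [n] rows and only [r * m] columns, whose left
    kernel is therefore nonzero. *)
Lemma common_left_kernel (F : fieldType) (n m r : nat)
    (A : 'I_r -> 'M[F]_(n, m)) :
  (r * m < n)%N ->
  exists2 x : 'rV[F]_n, x != 0 & forall i, x *m A i = 0.
Proof.
move=> lt_rm_n; pose B := \mxrow_(i < r) A i.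
have /rowV0Pn[x /sub_kermxP xB0 nz_x]: kermx B != 0.
  rewrite kermx_eq0 /row_free neq_ltn; apply/orP; left.
  by rewrite (leq_ltn_trans (rank_leq_col B)) // sum_nat_const card_ord.
exists x => // i; move: xB0; rewrite mul_mxrow => xB0.
by rewrite -(mxrowK (fun j => x *m A j) i) xB0; apply/matrixP => a b; rewrite !mxE.
Qed.

Section Orthogonality.

Variables (F : finFieldType) (L : fieldExtType F) (n : nat).
Implicit Types (x : 'rV[F]_n) (v : 'cV[L]_n).

(** Orthogonality phrased as inclusion in a kernel passes to smaller supports and to sums of
    supports. *)
Lemma colspace_sub_lker (m : nat) x (A : 'M[F]_(n, m)) :
  (colspace A <= lker (linfun (mulmx x : 'cV[F]_n -> 'cV[F]_1)))%VS
    = (x *m A == 0).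
Proof.
apply/span_subvP/eqP => [kA | xA0 _ /mapP[j _ ->]].
  apply/matrixP => i j; rewrite mxE.
  have: col j A \in lker (linfun (mulmx x : 'cV[F]_n -> 'cV[F]_1)).
    by apply/kA/map_f; rewrite mem_enum.
  rewrite memv_ker lfunE /= colE mulmxA -colE => /eqP/matrixP/(_ i 0).
  by rewrite !mxE.
by rewrite memv_ker lfunE /= colE mulmxA xA0 mul0mx.
Qed.

(** Coordinates are F-linear and [x] has entries in [F], so the row [x *m coord_mx G v] lists the
    coordinates in [G] of the scalar x . v. *)
Lemma mul_coord_mx_eq0 (m : nat) (G : m.-tuple L) x v :
  basis_of {:L} G ->
  (x *m coord_mx G v == 0) = (map_mx (in_alg L) x *m v == 0).
Proof.
move=> bG.
set y := map_mx (in_alg L) x *m v.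
have coordE j : coord G j (y 0 0) = (x *m coord_mx G v) 0 j.
  rewrite !mxE linear_sum; apply: eq_bigr => i _.
  by rewrite !mxE /= mulr_algl linearZ.
apply/eqP/eqP => [xv0 | xv0]; apply/matrixP => i j; rewrite !ord1.
  rewrite [RHS]mxE (coord_basis bG (memvf (y 0 0))) big1 // => l _.
  by rewrite coordE xv0 mxE scale0r.
by rewrite -coordE xv0 !mxE linear0.
Qed.

Lemma rank_support_sub_lker x v :
  (rank_support v <= lker (linfun (mulmx x : 'cV[F]_n -> 'cV[F]_1)))%VS
    = (map_mx (in_alg L) x *m v == 0).
Proof. by rewrite colspace_sub_lker mul_coord_mx_eq0 ?vbasisP. Qed.

Lemma nondegenerate_orthogonal_eq0 (C : {vspace 'cV[L]_n}) x :
  nondegenerate_code C ->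
  (forall v, v \in C -> map_mx (in_alg L) x *m v = 0) -> x = 0.
Proof.
move=> ndC xC0.
have full_ker : (fullv <= lker (linfun (mulmx x : 'cV[F]_n -> 'cV[F]_1)))%VS.
  rewrite -ndC; apply/subv_sumP => v vC.
  by rewrite rank_support_sub_lker; apply/eqP/xC0.
(* The identity matrix serves as a test matrix: its product with [x] is [x] itself. *)
have x1 : x *m 1%:M == 0.
  by rewrite -colspace_sub_lker (subv_trans (subvf _) full_ker).
by apply/eqP; rewrite -[x]mulmx1.
Qed.

(** By L-linearity a basis of [W] suffices, and each basis vector costs [\dim {:L}] equations over
    [F]. *)
Lemma orthogonal_vector_exists (W : {vspace 'cV[L]_n}) :
  (\dim W * \dim {:L} < n)%N ->
  exists2 x : 'rV[F]_n, x != 0 & forall w, w \in W -> map_mx (in_alg L) x *m w = 0.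
Proof.
move=> ltWn; pose A (i : 'I_(\dim W)) := coord_mx (vbasis {:L}) (vbasis W)`_i.
have [x nz_x xA0] := common_left_kernel _ _ _ _ A ltWn.
exists x => // w /coord_vbasis->.
rewrite mulmx_sumr big1 // => i _; rewrite -scalemxAr.
have /eqP := xA0 i; rewrite mul_coord_mx_eq0 ?vbasisP // => /eqP->.
by rewrite scaler0.
Qed.

End Orthogonality.

Lemma exists_small_complement (K : fieldType) (V : vectType K)
    (C : {vspace V}) (v v' : V) :
  v \in C -> v' \in C -> v' \notin <[v]>%VS ->
  exists W : {vspace V},
    [/\ v \in W, (C <= W + <[v']>)%VS & (\dim W < \dim C)%N].
Proof.
move=> vC v'C v'v; pose U := (<[v]> + <[v']>)%VS.
(* Replacing [U] by the line of [v] loses a dimension, even for [v = 0], where [U] is the line of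
   [v']. *)
exists (<[v]> + (C :\: U))%VS; split.
- exact: subvP (addvSl _ _) _ (memv_line v).
- by rewrite -addvA [(_ + <[v']>)%VS]addvC addvA addvC addv_diff addvSl.
have UC : (U <= C)%VS by rewrite subv_add -!memvE vC.
have ltvU : (\dim <[v]> < \dim U)%N.
  rewrite ltnNge; apply: contra v'v => leU; rewrite memvE.
  have /eqP-> : <[v]>%VS == U by rewrite eqEdim addvSl leU.
  exact: addvSr.
rewrite (leq_ltn_trans (dimv_add_leqif _ _)) //.
by rewrite -(dimv_cap_compl C U) (capv_idPr UC) ltn_add2r.
Qed.

Theorem proposition6p2 (F : finFieldType) (L : fieldExtType F)
    (n m k : nat) (C : {vspace 'cV[L]_n}) :
  (0 < n)%N -> (0 < m)%N -> (0 < k)%N ->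
  \dim {:L} = m ->
  \dim C = k ->
  nondegenerate_code C ->
  ((k - 1) * m + 1 <= n)%N ->
  minimal_code C.
Proof.
move=> _ _ _ dimL dimC ndC; rewrite addn1 => lt_n v v' vC v'C suppS.
apply/vlineP/idPn => v'v.
have [W [vW CW ltWC]] := exists_small_complement _ _ _ _ _ vC v'C v'v.
have [|x nz_x xW] := orthogonal_vector_exists F L n W.
  apply: leq_ltn_trans lt_n; rewrite dimL leq_mul2r; apply/orP; right.
  by rewrite -dimC subn1 -ltnS (ltn_predK ltWC).
case/eqP: nz_x; apply: (nondegenerate_orthogonal_eq0 _ _ _ _ _ ndC) => c /(subvP CW).
case/memv_addP=> w wW [_ /vlineP[a ->] ->].
(* As [v] lies in [W], the kernel of [x] contains the support of [v], hence that of [v']. *)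
have /eqP xv' : map_mx (in_alg L) x *m v' == 0.
  rewrite -rank_support_sub_lker (subv_trans suppS) //.
  by rewrite rank_support_sub_lker xW.
by rewrite mulmxDr xW // -scalemxAr xv' scaler0 addr0.
Qed.
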